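(* Let $N\in\mathbb{N}$. Then for every positive integer $n$, \begin{equation*} a(n, N) = \mathrm{ssptd}_{o}(n, N) - \mathrm{ssptd}_{o}(n-N, N). \end{equation*}
   Context: $a(n,N)$ is the number of partitions $\pi$ of $n$ with largest part $l(\pi)\leq N$ in which only the largest part may repeat. $\mathrm{ssptd}_o(n,N)$ is the sum of the smallest parts $s(\pi)$ over all partitions $\pi$ of $n$ into an odd number of distinct parts satisfying $l(\pi)-s(\pi)\leq N-1$; it is $0$ for $n\leq 0$. *)

(* Defs.v *)
From mathcomp Require Import all_boot all_order all_algebra.

Set Implicit Arguments.
Unset Strict Implicit.
Unset Printing Implicit Defensive.

Import Order.TTheory GRing.Theory Num.Theory.

Definition is_partition (n : nat) (p : seq nat) : bool :=
  [&& sorted geq p, all (leq 1) p & sumn p == n].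

(* A partition of n has at most n parts, each at most n, so it is found among
   the sequences of length at most n over 'I_n.+1; see partitionsP. *)
Definition parts (n : nat) (p : n.-bseq 'I_n.+1) : seq nat := map val p.

Definition partitions (n : nat) : {set n.-bseq 'I_n.+1} :=
  [set p : n.-bseq 'I_n.+1 | is_partition n (parts p)].

Lemma parts_inj (n : nat) : injective (@parts n).
Proof. by move=> p q /(inj_map val_inj) /val_inj. Qed.

Lemma partitionsP (n : nat) (s : seq nat) :
  reflect (exists2 p, p \in partitions n & parts p = s) (is_partition n s).
Proof.
apply: (iffP idP) => [Hs|[p]]; last by rewrite inE => Hp <-.
have /and3P[_ pos_s /eqP sum_s] := Hs.
have size_s : size s <= n.
  rewrite -sum_s; elim: s pos_s {Hs sum_s} => //= x s IHs /andP[x_gt0 /IHs].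
  by move=> le_s; rewrite -add1n leq_add.
have le_s x : x \in s -> x < n.+1.
  by move=> /perm_to_rem /perm_sumn; rewrite ltnS -sum_s => -> /=; apply: leq_addr.
have size_t : size (map (fun x => inord x : 'I_n.+1) s) <= n by rewrite size_map.
have parts_t : parts (Bseq size_t) = s.
  rewrite /parts /= -map_comp; apply: map_id_in => x /le_s x_le /=.
  exact: inordK.
by exists (Bseq size_t) => //; rewrite inE parts_t.
Qed.

(* The parts are listed in weakly decreasing order. *)
Definition largest_part (p : seq nat) : nat := head 0 p.
Definition smallest_part (p : seq nat) : nat := last 0 p.

Definition only_largest_repeats (p : seq nat) : bool :=
  all (fun x => (1 < count_mem x p) ==> (x == largest_part p)) p.

Definition a (n N : nat) : nat :=
  #|[set p in partitions n |
      (largest_part (parts p) <= N) && only_largest_repeats (parts p)]|.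

Definition ssptd_o (n : int) (N : nat) : nat :=
  if (n <= 0)%R then 0 else
  \sum_(p in partitions `|n|%N |
          [&& odd (size (parts p)), uniq (parts p) &
              ((largest_part (parts p))%:Z - (smallest_part (parts p))%:Z
                 <= N%:Z - 1)%R])
     smallest_part (parts p).

(* Main.v *)
Require Import Defs.
From mathcomp Require Import all_boot all_order all_algebra.
From mathcomp Require Import zify ring.

Set Implicit Arguments.
Unset Strict Implicit.
Unset Printing Implicit Defensive.

(** Let O(i, k) and E(i, k) be the generating functions of the subsets of
    {i, ..., i + k - 1} of odd, resp. even, size, weighted by q^(sum).  Splitting
    off the first or the last element of a window gives
      (1 - q^N) q^s E(s+1, N-1) = O(s, N) - O(s+1, N).
    The series of ssptd_o(-, N) is the sum over s >= 1 of s q^s E(s+1, N-1), so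
    by Abel summation multiplying it by 1 - q^N gives B_N, the sum of the
    O(s, N) over s >= 1.  Then B_N - B_(N-1) is the sum of q^(s+N-1) E(s, N-1),
    which telescopes by the same identity to q^N / (1 - q^N) O(0, N), and
    O(0, N) = O(1, N-1) + E(1, N-1) is the product of the 1 + q^j for
    0 < j < N.  This is the series of the partitions with largest part exactly
    N in which only N may repeat.  All series are truncated to polynomials: M
    bounds the summation range, and coefficients up to degree M are exact. *)

Import Order.TTheory GRing.Theory Num.Theory.

(** * Subsets of an integer interval as strictly decreasing lists *)

Fixpoint subseqs (T : eqType) (l : seq T) : seq (seq T) :=
  if l is x :: l' then [seq x :: t | t <- subseqs l'] ++ subseqs l'
  else [:: [::]].

Lemma mem_subseqs (T : eqType) (l t : seq T) : (t \in subseqs l) = subseq t l.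
Proof.
elim: l t => [|x l IH] t; first by rewrite inE subseq0.
rewrite [subseqs _]/= mem_cat IH; case: t => [|y t].
  by rewrite !sub0seq orbT.
rewrite [RHS]/=; case: eqP => [->|neq_yx].
  rewrite mem_map => [|? ? [->]] //; rewrite IH.
  case: (boolP (subseq t l)) => //= nsub.
  by apply: contraNF nsub; apply: subseq_trans; apply: subseq_cons.
by case: mapP => // -[u _ [/neq_yx]].
Qed.

Lemma subseqs_uniq (T : eqType) (l : seq T) : uniq l -> uniq (subseqs l).
Proof.
elim: l => //= x l IH /andP[xNl /IH uniq_l].
rewrite cat_uniq uniq_l map_inj_uniq ?uniq_l => [|? ? [->]] //.
rewrite andbT; apply/hasPn => t; rewrite mem_subseqs => sub_t.
by apply: contra xNl => /mapP[u _ tE]; rewrite (mem_subseq sub_t) ?tE ?mem_head.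
Qed.

Lemma rev_iotaS i k : rev (iota i k.+1) = (i + k) :: rev (iota i k).
Proof. by rewrite -addn1 iotaD rev_cat. Qed.

Lemma mem_rev_iota i k x : (x \in rev (iota i k)) = (i <= x < i + k).
Proof. by rewrite mem_rev mem_iota. Qed.

Lemma sorted_rev_iota i k : sorted gtn (rev (iota i k)).
Proof. by rewrite rev_sorted iota_ltn_sorted. Qed.

Lemma rev_iota_uniq i k : uniq (rev (iota i k)).
Proof. by rewrite rev_uniq iota_uniq. Qed.

Lemma gtn_trans : transitive gtn.
Proof. by move=> y x z /= xy yz; apply: ltn_trans xy. Qed.

Lemma geq_trans : transitive geq.
Proof. by move=> y x z /= xy yz; apply: leq_trans xy. Qed.

Lemma sorted_gtn_uniq_geq t : sorted gtn t = uniq t && sorted geq t.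
Proof.
have := ltn_sorted_uniq_leq (rev t); rewrite rev_uniq.
by rewrite !rev_sorted.
Qed.

(** A strictly decreasing list is determined by its members, so [t] coincides with the interval
    filtered by membership in [t]. *)
Lemma subseq_rev_iota i k t :
  subseq t (rev (iota i k)) =
  sorted gtn t && all (fun x => i <= x < i + k) t.
Proof.
apply/idP/andP => [sub_t|[sort_t all_t]].
  split; first exact: (subseq_sorted gtn_trans sub_t (sorted_rev_iota i k)).
  by apply/allP => x /(mem_subseq sub_t); rewrite mem_rev_iota.
have -> : t = [seq x <- rev (iota i k) | x \in t].
  apply: (irr_sorted_eq gtn_trans ltnn) => //.
    exact/(sorted_filter gtn_trans)/sorted_rev_iota.
  move=> x; rewrite mem_filter mem_rev_iota.
  by case: (boolP (x \in t)) => // /(allP all_t) ->.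
exact: filter_subseq.
Qed.

Local Open Scope ring_scope.

(** * Generating functions of subsets of given parity *)

Definition parity_gf (b : bool) (l : seq nat) : {poly int} :=
  \sum_(t <- subseqs l | odd (size t) == b) 'X^(sumn t).

Lemma parity_gf_nil b : parity_gf b [::] = (~~ b)%:R.
Proof. by rewrite /parity_gf /= big_cons big_nil; case: b; rewrite //= addr0. Qed.

Lemma parity_gf_cons b x l :
  parity_gf b (x :: l) = parity_gf b l + 'X^x * parity_gf (~~ b) l.
Proof.
rewrite /parity_gf /= big_cat big_map addrC; congr (_ + _).
rewrite mulr_sumr; apply: eq_big => [t|t _] /=; last by rewrite exprD.
by case: b; case: (odd _).
Qed.

Lemma parity_gf_rcons b x l :
  parity_gf b (rcons l x) = parity_gf b l + 'X^x * parity_gf (~~ b) l.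
Proof.
elim: l b => [|y l IH] b; first by rewrite parity_gf_cons.
by rewrite rcons_cons !parity_gf_cons !IH !negbK; ring.
Qed.

(** This is O(i, k) for [b = true] and E(i, k) for [b = false]. The interval is reversed so that its
    sublists are already in the order in which parts are listed. *)
Definition window_gf b i k : {poly int} := parity_gf b (rev (iota i k)).

Lemma window_gf_recl b i k :
  window_gf b i k.+1 = window_gf b i.+1 k + 'X^i * window_gf (~~ b) i.+1 k.
Proof. by rewrite /window_gf /= rev_cons parity_gf_rcons. Qed.

Lemma window_gf_recr b i k :
  window_gf b i k.+1 = window_gf b i k + 'X^(i + k) * window_gf (~~ b) i k.
Proof. by rewrite /window_gf rev_iotaS parity_gf_cons. Qed.

(** Both windows on the right extend {i+1, ..., i+k}, one by [i] in front and the other by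
    [i + k + 1] at the end. The common term O(i+1, k) cancels. *)
Lemma window_gf_shift i k :
  (1 - 'X^(k.+1)) * ('X^i * window_gf false i.+1 k) =
  window_gf true i k.+1 - window_gf true i.+1 k.+1.
Proof.
rewrite (window_gf_recl true i) (window_gf_recr true i.+1).
by rewrite addSnnS exprD; ring.
Qed.

(** A subset of odd size is nonempty, so its sum is at least [i]. This makes the boundary terms
    starting at [M] or [M.+1] harmless in low degree. *)
Lemma window_gf_dvdX i k : exists q, window_gf true i k = 'X^i * q.
Proof.
elim: k => [|k [q IH]].
  by exists 0; rewrite /window_gf parity_gf_nil mulr0.
exists (q + 'X^k * window_gf false i k).
by rewrite window_gf_recr IH exprD; ring.
Qed.

Lemma coef_window_gf0 i k n (p : {poly int}) :
  (n < i)%N -> (p * window_gf true i k)`_n = 0.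
Proof.
by have [q ->] := window_gf_dvdX i k; rewrite mulrCA coefXnM => ->.
Qed.

(** * The truncated series and the identities between them *)

(** [L] stands for N - 1, and [s] is the smallest part; the other parts form a subset of even size
    of {s+1, ..., s+L}. *)
Definition ssptd_gf M L : {poly int} :=
  \sum_(s <- iota 1 M) s%:R * ('X^s * window_gf false s.+1 L).

(** [h] is the largest part and [m] its multiplicity. The two parities together range over all
    subsets of {1, ..., h-1}. *)
Definition a_gf M N : {poly int} :=
  \sum_(h <- iota 1 N) \sum_(m <- iota 1 M)
    'X^(m * h) * (window_gf true 1 h.-1 + window_gf false 1 h.-1).

Definition odd_windows_gf M N : {poly int} :=
  \sum_(s <- iota 1 M) window_gf true s N.

(* Abel summation of [window_gf_shift]. *)
Lemma ssptd_gf_shift M L :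
  (1 - 'X^(L.+1)) * ssptd_gf M L =
  odd_windows_gf M L.+1 - M%:R * window_gf true M.+1 L.+1.
Proof.
rewrite /ssptd_gf /odd_windows_gf; elim: M => [|M IH].
  by rewrite !big_nil; ring.
rewrite -[M.+1]addn1 iotaD !big_cat !big_seq1 mulrDr IH add1n addn1.
by rewrite mulrCA window_gf_shift -natr1 /=; ring.
Qed.

(* Iterates U = X^(k+1) U + (1 - X^(k+1)) U, the second term telescoping. *)
Lemma even_windows_gf_unroll M k m :
  let U := \sum_(i <- iota 0 M) 'X^i * window_gf false i.+1 k in
  U = (\sum_(j <- iota 0 m) 'X^(j * k.+1))
      * (window_gf true 0 k.+1 - window_gf true M k.+1)
      + 'X^(m * k.+1) * U.
Proof.
move=> U.
have telescope :
    (1 - 'X^(k.+1)) * U = window_gf true 0 k.+1 - window_gf true M k.+1.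
  rewrite /U; elim: M {U} => [|M IH]; first by rewrite big_nil; ring.
  by rewrite -[M.+1]addn1 iotaD big_cat big_seq1 /= add0n mulrDr IH
             window_gf_shift addn1 /=; ring.
elim: m => [|m IH]; first by rewrite big_nil; ring.
rewrite -[m.+1]addn1 iotaD big_cat big_seq1 /= add0n {1}IH -telescope addn1.
by rewrite mulSn exprD; ring.
Qed.

Lemma coef_odd_windows_gf M N n :
  (n <= M)%N -> (odd_windows_gf M N)`_n = (a_gf M N)`_n.
Proof.
move=> le_nM; elim: N => [|k IH].
  rewrite /odd_windows_gf /a_gf big_nil big1 // => s _.
  by rewrite /window_gf parity_gf_nil.
(* Removing the last element [s + k] of each window, with s = i + 1, leaves the increment X^(k+1)
   U. *)
have -> : odd_windows_gf M k.+1 = odd_windows_gf M k +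
    'X^(k.+1) * \sum_(i <- iota 0 M) 'X^i * window_gf false i.+1 k.
  rewrite /odd_windows_gf mulr_sumr -[1%N]/(1 + 0)%N iotaDl !big_map -big_split.
  by apply: eq_bigr => i _; rewrite window_gf_recr !add1n addSnnS exprD /=; ring.
(* The new terms have largest part [k.+1] with multiplicity m = j + 1. Since X^0 = 1, O(0, k+1) is
   O(1, k) + E(1, k). *)
have -> : a_gf M k.+1 = a_gf M k +
    'X^(k.+1) * ((\sum_(j <- iota 0 M) 'X^(j * k.+1)) * window_gf true 0 k.+1).
  rewrite /a_gf -[X in iota 1 X]addn1 iotaD big_cat big_seq1 /= add1n.
  congr (_ + _); rewrite mulr_suml mulr_sumr -[1%N]/(1 + 0)%N iotaDl big_map.
  apply: eq_bigr => i _.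
  by rewrite window_gf_recl expr0 mul1r mulrA -exprD -mulSn.
rewrite !coefD IH; congr (_ + _).
have [q wE] := window_gf_dvdX M k.+1.
rewrite (even_windows_gf_unroll M k M) wE.
set S := \sum_(j <- _) _; set U := \sum_(i <- _) _.
(* After [M] unrollings, both the remainder and the boundary window at [M] are multiples of X^(M+1),
   hence invisible in degree n <= M. *)
have -> : 'X^(k.+1) * (S * (window_gf true 0 k.+1 - 'X^M * q) + 'X^(M * k.+1) * U)
   = 'X^(k.+1) * (S * window_gf true 0 k.+1)
     + 'X^(M.+1) * ('X^(M * k + k) * U - 'X^k * S * q).
  by rewrite mulnS !exprD !exprS; ring.
by rewrite coefD [X in _ + X]coefXnM ltnS le_nM addr0.
Qed.

(** * From sums over partitions to coefficients *)

(** Taking the coefficient discards the lists in [E] whose sum is not [n], so one finite family [E]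
    can serve all degrees up to the truncation bound. *)
Lemma sum_partitions n (P : pred (seq nat)) (F : seq nat -> int)
    (E : seq (seq nat)) :
  uniq E ->
  (forall s, is_partition n s && P s = (s \in E) && (sumn s == n)) ->
  \sum_(p in partitions n | P (parts p)) F (parts p) =
  (\sum_(s <- E) (F s)%:P * 'X^(sumn s))`_n.
Proof.
move=> uniqE memE.
have -> : (\sum_(s <- E) (F s)%:P * 'X^(sumn s))`_n =
          \sum_(s <- E | sumn s == n) F s.
  rewrite coef_sum [RHS]big_mkcond; apply: eq_bigr => s _.
  by rewrite coefCM coefXn eq_sym; case: eqP; rewrite ?mulr1 ?mulr0.
rewrite -[RHS]big_filter -big_enum_cond -big_filter.
rewrite -(big_map (@parts n) xpredT F); apply: perm_big; apply: uniq_perm.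
- by rewrite (map_inj_uniq (@parts_inj n)) filter_uniq ?enum_uniq.
- by rewrite filter_uniq.
move=> s; rewrite mem_filter andbC -memE; apply/mapP/andP => [[p]|[]].
  by rewrite mem_filter mem_enum inE => /andP[Pp part_p] ->.
move=> /partitionsP[p p_part <-] Pp; exists p => //.
by rewrite mem_filter mem_enum Pp p_part.
Qed.

Lemma sumn_rcons t x : sumn (rcons t x) = (sumn t + x)%N.
Proof. by rewrite -cats1 sumn_cat /= addn0. Qed.

Lemma leq_sumn t x : x \in t -> (x <= sumn t)%N.
Proof. by move=> /perm_to_rem /perm_sumn -> /=; apply: leq_addr. Qed.

Lemma sorted_gtn_rcons t s :
  sorted gtn (rcons t s) = sorted gtn t && all (fun x => s < x)%N t.
Proof.
rewrite -rev_sorted rev_rcons /= (path_sortedE (@ltn_trans)) rev_sorted.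
by rewrite all_rev andbC.
Qed.

(** * Partitions into an odd number of distinct parts *)

Definition distinct_partitions_in_window M L : seq (seq nat) :=
  [seq rcons t s | s <- iota 1 M,
     t <- [seq t <- subseqs (rev (iota s.+1 L)) | ~~ odd (size t)]].

Lemma distinct_partitions_in_window_uniq M L :
  uniq (distinct_partitions_in_window M L).
Proof.
apply: allpairs_uniq_dep; first exact: iota_uniq.
  by move=> s _; rewrite filter_uniq ?subseqs_uniq ?rev_iota_uniq.
by move=> [s t] [s' t'] _ _ /= /rcons_inj[-> ->].
Qed.

Lemma mem_distinct_partitions_in_window M L n p :
    (0 < n <= M)%N ->
  is_partition n p &&
    [&& odd (size p), uniq p &
        (largest_part p)%:Z - (smallest_part p)%:Z <= L.+1%:Z - 1] =
  (p \in distinct_partitions_in_window M L) && (sumn p == n).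
Proof.
move=> /andP[n_gt0 le_nM]; apply/andP/andP => [[]|[]].
  case/and3P=> sorted_p pos_p /eqP sum_p /and3P[odd_p uniq_p gap_p].
  split; last exact/eqP.
  case/lastP: p sorted_p pos_p sum_p odd_p uniq_p gap_p => // t s.
  move=> sorted_p pos_p sum_p odd_p uniq_p.
  rewrite /largest_part /smallest_part last_rcons => gap_p.
  have : sorted gtn (rcons t s) by rewrite sorted_gtn_uniq_geq uniq_p.
  rewrite sorted_gtn_rcons => /andP[sorted_t lt_t].
  have s_mem : s \in rcons t s by rewrite mem_rcons mem_head.
  apply/allpairsPdep; exists s, t; split=> //.
    rewrite mem_iota (allP pos_p s s_mem) add1n ltnS /=.
    by apply: leq_trans (leq_sumn s_mem) _; rewrite sum_p.
  rewrite mem_filter mem_subseqs subseq_rev_iota sorted_t.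
  move: odd_p; rewrite size_rcons /= => -> /=.
  apply/allP => x x_t; rewrite (allP lt_t x x_t) /=.
  (* The gap condition bounds only the head [y], which in turn bounds every other entry of the
     decreasing list. *)
  case: t sorted_t x_t gap_p {sorted_p pos_p sum_p uniq_p lt_t s_mem} => //= y t.
  rewrite (path_sortedE gtn_trans) inE => /andP[/allP lt_y _] x_t gap_p.
  have : (x <= y)%N by case/orP: x_t => [/eqP->|/lt_y /ltnW].
  lia.
move=> /allpairsPdep[s [t [s_M]]].
rewrite mem_filter mem_subseqs subseq_rev_iota.
move=> /and3P[odd_t sorted_t /allP win_t] -> sum_p.
move: s_M; rewrite mem_iota add1n => /andP[s_gt0 s_le].
have : sorted gtn (rcons t s).
  by rewrite sorted_gtn_rcons sorted_t; apply/allP => x /win_t /andP[].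
rewrite sorted_gtn_uniq_geq => /andP[uniq_p sorted_p]; split.
  rewrite /is_partition sorted_p sum_p andbT; apply/allP => x.
  by rewrite mem_rcons inE => /orP[/eqP->//|/win_t /andP[]]; lia.
rewrite size_rcons /= odd_t uniq_p /= /largest_part /smallest_part last_rcons.
case: t win_t {odd_t sorted_t sum_p uniq_p sorted_p} => [|y t] win_t /=; first lia.
by have := win_t y (mem_head _ _); lia.
Qed.

Lemma ssptd_o_coef M L n : (0 < n <= M)%N ->
  (ssptd_o n%:Z L.+1)%:Z = (ssptd_gf M L)`_n.
Proof.
move=> n_M; rewrite /ssptd_o ifF; last lia.
rewrite absz_nat -natz natr_sum.
under eq_bigr do rewrite natz.
rewrite (@sum_partitions n _ (fun p => (smallest_part p)%:Z)
  (distinct_partitions_in_window M L) (distinct_partitions_in_window_uniq M L)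
  (fun p => mem_distinct_partitions_in_window L p n_M)).
rewrite big_allpairs_dep /ssptd_gf; apply: (congr1 (fun q : {poly int} => q`_n)).
apply: eq_bigr => s _.
rewrite big_filter !mulr_sumr; apply: eq_big => t; first by case: odd.
move=> _; rewrite /smallest_part last_rcons sumn_rcons addnC exprD -natz.
by rewrite raddfMn.
Qed.

(** * Partitions in which only the largest part may repeat *)

Definition flat_top_partitions M N : seq (seq nat) :=
  [seq nseq mh.1 mh.2 ++ t | mh <- [seq (m, h) | h <- iota 1 N, m <- iota 1 M],
     t <- subseqs (rev (iota 1 mh.2.-1))].

Lemma flat_topP M N p :
  reflect (exists m h t, [/\ p = nseq m h ++ t, (0 < m <= M)%N, (0 < h <= N)%N,
             sorted gtn t & all (fun x => 0 < x < h)%N t])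
          (p \in flat_top_partitions M N).
Proof.
apply: (iffP allpairsPdep) => [[[m h] [t []]]|[m [h [t [-> m_M h_N st at_]]]]].
  case/allpairsPdep=> [h' [m' []]]; rewrite !mem_iota => h_N m_M [-> ->] /=.
  rewrite mem_subseqs subseq_rev_iota => /andP[st at_] ->.
  exists m', h', t; rewrite !add1n !ltnS in h_N m_M; split=> //.
  by apply: sub_all at_ => x; lia.
exists (m, h), t; split=> //.
  by apply/allpairsPdep; exists h, m; rewrite !mem_iota !add1n !ltnS.
rewrite mem_subseqs subseq_rev_iota st /=.
by apply: sub_all at_ => x; lia.
Qed.

(** Serves to show that distinct triples (h, m, t) encode distinct partitions. *)
Lemma nseq_cat_recover m h (t : seq nat) : (0 < m)%N -> all (ltn^~ h) t ->
  let p := nseq m h ++ t in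
  (head 0%N p, count_mem h p, [seq x <- p | x != h]) = (h, m, t).
Proof.
move=> m_gt0 lt_t p; have hNt : h \notin t.
  by apply/negP => /(allP lt_t); rewrite /= ltnn.
rewrite /p count_cat count_nseq (count_memPn hNt) filter_cat filter_nseq /= !eqxx.
rewrite mul1n addn0; congr (_, _, _); first by case: m m_gt0 {p}.
by apply/all_filterP/allP => x x_t; apply: contraNneq hNt => <-.
Qed.

Lemma flat_top_partitions_uniq M N : uniq (flat_top_partitions M N).
Proof.
apply: allpairs_uniq_dep.
- by apply: allpairs_uniq; rewrite ?iota_uniq // => -[? ?] [? ?] _ _ /= [-> ->].
- by move=> [m h] _; rewrite subseqs_uniq ?rev_iota_uniq.
move=> u v /allpairsPdep[[m h] [t [mh_MN sub_t ->]]].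
move=> /allpairsPdep[[m' h'] [t' [mh'_MN sub_t' ->]]] /=.
have lt_h m0 h0 t0 : (m0, h0) \in [seq (m, h) | h <- iota 1 N, m <- iota 1 M] ->
    t0 \in subseqs (rev (iota 1 h0.-1)) -> (0 < m0)%N && all (ltn^~ h0) t0.
  case/allpairsPdep=> [h1 [m1 []]]; rewrite !mem_iota => h_N m_M [-> ->].
  rewrite mem_subseqs subseq_rev_iota => /andP[_ all_t0].
  by case/andP: m_M => -> _; apply: sub_all all_t0 => x /=; lia.
case/andP: (lt_h _ _ _ mh_MN sub_t) => m_gt0 lt_t.
case/andP: (lt_h _ _ _ mh'_MN sub_t') => m'_gt0 lt_t' pE.
have [] := nseq_cat_recover m_gt0 lt_t; have [] := nseq_cat_recover m'_gt0 lt_t'.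
by rewrite pE => -> cE' tE' hE; rewrite -hE cE' tE' => -> ->.
Qed.

Lemma mem_flat_top_partitions M N n p : (0 < n <= M)%N ->
  is_partition n p && ((largest_part p <= N)%N && only_largest_repeats p) =
  (p \in flat_top_partitions M N) && (sumn p == n).
Proof.
move=> /andP[n_gt0 le_nM]; apply/andP/andP => [[]|[]].
  case/and3P=> sorted_p pos_p /eqP sum_p /andP[le_N rep_p].
  split; last exact/eqP.
  set h := largest_part p in le_N.
  have h_p : h \in p.
    case: p @h {rep_p le_N sorted_p pos_p} sum_p n_gt0 => [h <-|y q h _ _] //.
    exact: mem_head.
  have le_h x : x \in p -> (x <= h)%N.
    case: p @h sorted_p {pos_p sum_p rep_p le_N h_p} => //= y p.
    rewrite (path_sortedE geq_trans) inE => /andP[/allP le_y _].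
    by case/orP=> [/eqP->|/le_y].
  pose t := [seq x <- p | x != h].
  (* Both sides are weakly decreasing and are permutations of each other, hence equal. *)
  have pE : p = nseq (count_mem h p) h ++ t.
    apply: (sorted_eq geq_trans) => //.
    - by move=> x y /=; lia.
    - rewrite sorted_pairwise ?pairwise_cat; last exact: geq_trans.
      rewrite -!sorted_pairwise; try exact: geq_trans.
      rewrite (sorted_filter geq_trans) // andbT.
      apply/andP; split.
        apply/allrelP => x y /nseqP[-> _]; rewrite mem_filter => /andP[_].
        exact: le_h.
      by elim: (count_mem h p) => // -[|m] //= ->; rewrite andbT.
    rewrite -(perm_filterC (pred1 h)) perm_cat2r -size_filter.
    by have /all_pred1P -> := filter_all (pred1 h) p; rewrite size_nseq.
  have m_gt0 : (0 < count_mem h p)%N by rewrite -has_count has_pred1.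
  have h_gt0 := allP pos_p h h_p.
  apply/flat_topP; exists (count_mem h p), h, t; split=> //.
  (* The copies of [h] contribute m h <= n with h >= 1, so m <= n <= M. *)
  - have := congr1 sumn pE; rewrite sumn_cat sumn_nseq sum_p.
    move: (count_mem h p) (sumn t) m_gt0 h_gt0 => m r /=; nia.
  - by rewrite h_gt0.
  - rewrite sorted_gtn_uniq_geq (sorted_filter geq_trans) // andbT.
    (* An entry occurring twice in [t] would occur twice in [p], hence equal [h], which [t]
       excludes. *)
    apply: count_mem_uniq => x; case: (boolP (x \in t)) => [x_t|/count_memPn] //.
    apply/eqP; rewrite eqn_leq -has_count has_pred1 x_t andbT.
    apply: leq_trans (leq_count_subseq _ (filter_subseq _ _)) _.
    move: x_t; rewrite mem_filter leqNgt => /andP[x_h x_p].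
    by apply: contra x_h; apply/implyP/(allP rep_p).
  apply/allP => x; rewrite mem_filter => /andP[x_h x_p].
  by rewrite (allP pos_p x x_p) ltn_neqAle x_h le_h.
move=> /flat_topP[m [h [t [-> m_M h_N sorted_t lt_t]]]] sum_p.
have sorted_t' := sorted_t.
rewrite sorted_gtn_uniq_geq in sorted_t'; case/andP: sorted_t' => uniq_t geq_t.
have largest : largest_part (nseq m h ++ t) = h by case: m m_M {sum_p}.
split.
  rewrite /is_partition sum_p andbT; apply/andP; split.
    rewrite sorted_pairwise ?pairwise_cat; last exact: geq_trans.
    rewrite -!sorted_pairwise; try exact: geq_trans.
    rewrite geq_t andbT; apply/andP; split.
      apply/allrelP => x y /nseqP[-> _] /(allP lt_t); lia.
    by elim: (m) => // -[|k] //= ->; rewrite andbT.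
  rewrite all_cat all_nseq; case/andP: h_N => -> _; rewrite orbT /=.
  by apply: sub_all lt_t => x /andP[].
rewrite /only_largest_repeats largest; case/andP: h_N => _ -> /=.
rewrite all_cat; apply/andP; split; apply/allP => x.
  by move=> /nseqP[-> _]; rewrite eqxx implybT.
move=> x_t; apply/implyP; rewrite count_cat count_nseq count_uniq_mem // x_t /=.
by case: eqP => // ->; rewrite eqxx.
Qed.

Lemma a_coef M N n : (0 < n <= M)%N -> (a n N)%:Z = (a_gf M N)`_n.
Proof.
move=> n_M; rewrite /a -sum1_card -natz natr_sum.
rewrite (eq_bigl (fun p => (p \in partitions n) &&
    ((largest_part (parts p) <= N)%N && only_largest_repeats (parts p))));
  last first.
  by move=> p; rewrite inE.
rewrite (@sum_partitions n _ (fun=> 1) (flat_top_partitions M N)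
  (flat_top_partitions_uniq M N) (fun p => mem_flat_top_partitions N p n_M)).
apply: (congr1 (fun q : {poly int} => q`_n)).
rewrite big_allpairs_dep big_allpairs_dep; apply: eq_bigr => h _.
apply: eq_bigr => m _; rewrite /window_gf /parity_gf /=.
(* Splitting the lists [t] by parity of size yields the two window series in [a_gf]. *)
rewrite (bigID (fun t => odd (size t))) mulrDr !mulr_sumr /=.
by congr (_ + _); apply: eq_big => [t|t _]; rewrite ?eqb_id ?eqbF_neg //;
  rewrite sumn_cat sumn_nseq mulnC exprD mul1r.
Qed.

Close Scope ring_scope.

(** * Comparison of the coefficients of degree [n] *)

Theorem theorem2p7 (N n : nat) (n_gt0 : 0 < n) :
  ((a n N)%:Z = (ssptd_o n%:Z N)%:Z - (ssptd_o (n%:Z - N%:Z) N)%:Z)%R.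
Proof.
have n_le : 0 < n <= n by rewrite n_gt0 /=.
case: N => [|L].
  (* For N = 0 the two terms on the right coincide, and no largest part is available on the left. *)
  by rewrite subr0 subrr (a_coef 0 n_le) /a_gf big_nil coef0.
rewrite (a_coef _ n_le) -coef_odd_windows_gf // (ssptd_o_coef _ n_le).
have := congr1 (fun q : {poly int} => q`_n)%R (ssptd_gf_shift n L).
(* With truncation bound M = n, the Abel boundary term involves O(n+1, L+1), which has no term of
   degree [n]. *)
rewrite /= mulrBl mul1r !coefB coef_window_gf0 ?ltnSn // subr0 => <-.
congr (_ - _)%R; rewrite coefXnM.
have [le_nL|lt_Ln] := leqP n L.+1.
  (* For n <= N the shifted term is 0 by convention. At n = N this matches the constant coefficient
     of [ssptd_gf], which vanishes because s >= 1. *)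
  have -> : ssptd_o (n%:Z - L.+1%:Z) L.+1 = 0 by rewrite /ssptd_o ifT //; lia.
  case: ltnP => // le_Ln; have -> : n - L.+1 = 0 by lia.
  rewrite /ssptd_gf coef_sum big_seq big1 // => s.
  rewrite mem_iota mulrCA coefXnM => /andP[-> _] //.
(* The same bound M = n is valid for the smaller argument n - N. *)
rewrite ltnNge ltnW //= subzn 1?ltnW // (@ssptd_o_coef n) //; lia.
Qed.
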